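(* Let $G$ be a graph without loops, and let $T$ be a graph with a $\mathbb{Z}_2$-action which flips some edge in $T$. If, for some integers $k\geq 0$, $m\geq 1$, we have $\varpi_1^k(\mathrm{Hom}(T,G))\neq 0$ and $\varpi_1^k(\mathrm{Hom}(T,K_m))=0$, then $\chi(G)\geq m+1$.
   Context: Graphs are undirected: a graph $G$ has a vertex set $V(G)$ and a symmetric edge relation $E(G)\subseteq V(G)\times V(G)$. A graph homomorphism $G\to H$ is a map $V(G)\to V(H)$ taking edges to edges. $K_m$ is the complete graph: $V(K_m)=\{1,\dots,m\}$, $E(K_m)=\{(x,y)\mid x\neq y\}$. $\chi(G)$ is the chromatic number. For graphs $G$ and $H$, $\mathrm{Hom}(G,H)$ is the polyhedral complex whose cells are indexed by all functions $\eta:V(G)\to 2^{V(H)}\setminus\{\emptyset\}$ such that whenever $(x,y)\in E(G)$, $\tilde x\in\eta(x)$ and $\tilde y\in\eta(y)$, we have $(\tilde x,\tilde y)\in E(H)$. The cell $\eta$ is the direct product over $v\in V(G)$ of the simplices with vertex sets $\eta(v)$, and its closure consists of all cells $\tilde\eta$ with $\tilde\eta(v)\subseteq\eta(v)$ for all $v$. Equivalently, as a space it is the geometric realization of the poset of all such $\eta$ ordered by pointwise inclusion. A $\mathbb{Z}_2$-action on a graph $T$ is given by a graph homomorphism $\phi:T\to T$ with $\phi^2=\mathrm{id}$; it flips an edge if there exist $a,b\in V(T)$, $a\neq b$, $(a,b)\in E(T)$, with $\phi(a)=b$ (and hence $\phi(b)=a$). It induces a $\mathbb{Z}_2$-action on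 $\mathrm{Hom}(T,H)$ by $\eta\mapsto\eta\circ\phi$; when $\phi$ flips an edge and $H$ has no loops this action is free. For a CW complex $X$ with a free $\mathbb{Z}_2$-action there is a $\mathbb{Z}_2$-equivariant map $X\to S^\infty$ ($S^\infty$ with the antipodal action), and the induced map $w:X/\mathbb{Z}_2\to\mathbb{RP}^\infty$ is unique up to homotopy. Let $z$ be the nontrivial class in $H^1(\mathbb{RP}^\infty;\mathbb{Z}_2)$. The first Stiefel-Whitney class of $X$ is $\varpi_1(X)=w^*(z)\in H^1(X/\mathbb{Z}_2;\mathbb{Z}_2)$, and $\varpi_1^k(X)=w^*(z^k)\in H^k(X/\mathbb{Z}_2;\mathbb{Z}_2)$ is its $k$-th power. *)

(* Defs.v *)
From HB Require Import structures.
From mathcomp Require Import all_boot all_order all_algebra.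
From mathcomp Require Import all_classical all_reals all_analysis.

Set Implicit Arguments.
Unset Strict Implicit.
Unset Printing Implicit Defensive.

Import Order.TTheory GRing.Theory Num.Theory.
Import numFieldNormedType.Exports.

Local Open Scope classical_set_scope.
Local Open Scope quotient_scope.
Local Open Scope ring_scope.

Record graph := Graph {
  vertex :> Type;
  edge : vertex -> vertex -> Prop;
  edge_sym : forall x y, edge x y -> edge y x }.

Definition loopless (G : graph) := forall x : G, ~ edge x x.

Definition graph_hom (G H : graph) (f : G -> H) :=
  forall x y, edge x y -> edge (f x) (f y).

Lemma complete_edge_sym (m : nat) (x y : 'I_m) : x <> y -> y <> x.
Proof. by move=> xy /esym. Qed.

Definition complete_graph (m : nat) : graph :=
  Graph (@complete_edge_sym m).

Definition colorable (G : graph) (n : nat) :=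
  exists c : G -> 'I_n, forall x y, edge x y -> c x <> c y.

(* The value is +oo when no finite number of colors suffices. *)
Definition chromatic_number (R : realType) (G : graph) : \bar R :=
  ereal_inf [set (n%:R)%:E | n in colorable G].

Record graph_involution (T : graph) := GraphInvolution {
  invol :> T -> T;
  invol_hom : graph_hom invol;
  involK : involutive invol }.

Definition flips_edge (T : graph) (phi : graph_involution T) :=
  exists a b : T, [/\ a <> b, edge a b & phi a = b].

(* The union in Z of the images of the maps j, with the final topology for
   these maps. It gives the weak (CW) topology both on the realization of a
   poset and on the infinite sphere. *)
Section UnionSpace.
Context (I : Type) (A : I -> topologicalType) (Z : Type).
Variable j : forall i, A i -> Z.

Definition union_space : Type := {z : Z | exists i a, j (i := i) a = z}.

Definition union_in (i : I) (a : A i) : union_space :=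
  exist _ (j a) (ex_intro _ i (ex_intro _ a erefl)).

Definition union_open (U : set union_space) :=
  forall i, open (@union_in i @^-1` U).

Lemma union_openT : union_open setT.
Proof. by move=> i; rewrite preimage_setT; exact: openT. Qed.

Lemma union_openI : setI_closed union_open.
Proof. by move=> U V oU oV i; rewrite preimage_setI; exact: openI. Qed.

Lemma union_open_bigcup (K : Type) (U : K -> set union_space) :
  (forall k, union_open (U k)) -> union_open (\bigcup_k U k).
Proof.
move=> oU i; rewrite preimage_bigcup; apply: bigcup_open => k _; exact: oU.
Qed.

HB.instance Definition _ := gen_eqMixin union_space.
HB.instance Definition _ := gen_choiceMixin union_space.
HB.instance Definition _ := isOpenTopological.Build union_space
  union_openT union_openI union_open_bigcup.

Lemma union_in_continuous (i : I) : continuous (@union_in i).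
Proof. by apply/continuousP => U oU; exact: oU. Qed.

Lemma union_continuous (Y : topologicalType) (f : union_space -> Y) :
  (forall i, continuous (f \o @union_in i)) -> continuous f.
Proof.
move=> fc; apply/continuousP => U oU.
suff : union_open (f @^-1` U) by [].
by move=> i; have /continuousP/(_ U oU) := fc i.
Qed.

Lemma union_inj (x y : union_space) : sval x = sval y -> x = y.
Proof. by case: x y => [x px] [y py] /= xy; exact: eq_exist. Qed.

Lemma unionP (x : union_space) : exists i a, union_in (i := i) a = x.
Proof.
by case: x => z [i [a jz]]; exists i, a; exact: eq_exist.
Qed.
End UnionSpace.

Record z2space := Z2Space {
  z2carrier :> topologicalType;
  flip : z2carrier -> z2carrier;
  flipK : involutive flip;
  flip_continuous : continuous flip }.

Record z2map (X Y : z2space) := Z2Map {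
  z2fun :> X -> Y;
  z2fun_continuous : continuous z2fun;
  z2fun_flip : forall x, z2fun (flip x) = flip (z2fun x) }.

Section OrbitSpace.
Variable X : z2space.

Definition orbit_rel : rel X := fun x y => (y == x) || (y == flip x).

Lemma orbit_rel_class : equiv_class_of orbit_rel.
Proof.
split=> [x|x y|y x z]; rewrite /orbit_rel.
- by rewrite eqxx.
- rewrite [y == x]eq_sym; congr (_ || _).
  by apply/eqP/eqP => ->; rewrite flipK.
- case/orP => /eqP ->//.
  by case/orP => /eqP ->; rewrite ?flipK eqxx ?orbT.
Qed.

Definition orbit_equiv := EquivRelPack orbit_rel_class.

Definition orbit_space : topologicalType :=
  quotient_topology {eq_quot orbit_equiv}.

Definition orbit (x : X) : orbit_space := (\pi_({eq_quot orbit_equiv}) x)%qT.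
End OrbitSpace.

Lemma orbit_flip (X : z2space) (x : X) : orbit (flip x) = orbit x.
Proof.
by apply/eqmodP; rewrite /= /orbit_rel flipK eqxx orbT.
Qed.

Lemma orbitP (X : z2space) (x y : X) :
  orbit x = orbit y -> y = x \/ y = flip x.
Proof.
by move=> /eqmodP; rewrite /= /orbit_rel => /orP[] /eqP; [left|right].
Qed.

Section OrbitMap.
Context (X Y : z2space).
Variable u : z2map X Y.

Definition orbit_map_fun (p : orbit_space X) : orbit_space Y :=
  orbit (u (repr (p : {eq_quot orbit_equiv X}))).

Lemma orbit_map_funE (x : X) : orbit_map_fun (orbit x) = orbit (u x).
Proof.
rewrite /orbit_map_fun.
have : orbit (repr (orbit x : {eq_quot orbit_equiv X})) = orbit x.
  exact: reprK.
by case/orbitP => {2}->; rewrite ?z2fun_flip ?orbit_flip.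
Qed.

Lemma orbit_map_continuous : continuous orbit_map_fun.
Proof.
apply/quotient_continuous.
have -> : orbit_map_fun \o \pi_(quotient_topology {eq_quot orbit_equiv X})%qT
          = @orbit Y \o u.
  by apply/funext => x; exact: orbit_map_funE.
move=> x; apply: continuous_comp; first exact: z2fun_continuous.
exact: pi_continuous.
Qed.

Definition orbit_map : continuousType (orbit_space X) (orbit_space Y) :=
  mkcts orbit_map_continuous.
End OrbitMap.

Section Simplex.
Variable R : realType.

Definition simplex (n : nat) : set 'rV[R]_n.+1 :=
  [set t | (forall i, 0 <= t ord0 i) /\ \sum_i t ord0 i = 1].

(* The affine map Delta^m -> Delta^n that acts on vertices as f. *)
Definition affine (m n : nat) (f : 'I_m.+1 -> 'I_n.+1) (t : 'rV[R]_m.+1) :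
    'rV[R]_n.+1 :=
  \row_j \sum_(i | f i == j) t ord0 i.

Lemma affine_simplex m n (f : 'I_m.+1 -> 'I_n.+1) t :
  simplex t -> simplex (affine f t).
Proof.
case=> t0 t1; split=> [j|]; first by rewrite mxE; apply: sumr_ge0.
rewrite -t1 [RHS](partition_big f predT) //=.
by apply: eq_bigr => j _; rewrite mxE.
Qed.

Definition simplex_map_fun m n (f : 'I_m.+1 -> 'I_n.+1)
    (t : set_type (@simplex m)) : set_type (@simplex n) :=
  exist _ (affine f (val t)) (mem_set (affine_simplex f (set_valP t))).

Lemma simplex_coord_continuous n (i : 'I_n.+1) :
  continuous (fun t : set_type (@simplex n) => val t ord0 i).
Proof.
move=> t; have vt : {for t, continuous (@set_val _ (@simplex n))}.
  exact: initial_continuous.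
exact: (continuous_comp vt (@coord_continuous R 1 n.+1 ord0 i _)).
Qed.

Lemma matrix_continuous (X : topologicalType) m n (g : X -> 'M[R]_(m, n)) :
  (forall i j, continuous (fun x => g x i j)) -> continuous g.
Proof.
move=> gc x A [P nP sPA].
have nearP i j : \forall y \near x, P i j (g y i j) by exact/gc/nP.
have nearPP : \forall y \near x, forall i j, P i j (g y i j).
  exact: (filter_forall _ (fun i => filter_forall _ (nearP i))).
have sgA : [set y | forall i j, P i j (g y i j)] `<=` g @^-1` A.
  by move=> y Py; exact: sPA.
exact: filterS sgA nearPP.
Qed.

Lemma simplex_map_continuous m n (f : 'I_m.+1 -> 'I_n.+1) :
  continuous (simplex_map_fun f).
Proof.
apply: continuous_comp_initial; apply: matrix_continuous => i j.
under eq_fun do rewrite /= mxE.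
apply: continuous_big => [|k _]; first exact: add_continuous.
exact: simplex_coord_continuous.
Qed.

Definition simplex_map m n (f : 'I_m.+1 -> 'I_n.+1) :
    continuousType (set_type (@simplex m)) (set_type (@simplex n)) :=
  mkcts (@simplex_map_continuous m n f).

Definition singular (n : nat) (Y : topologicalType) :=
  continuousType (set_type (@simplex n)) Y.

Definition cochain (n : nat) (Y : topologicalType) := singular n Y -> 'F_2.

Definition reindex (Y : topologicalType) m n (s : singular n Y)
    (f : 'I_m.+1 -> 'I_n.+1) : singular m Y :=
  (s \o simplex_map f : continuousType _ _).

(* The class of a cocycle in H^n(Y; Z/2) vanishes if and only if the cocycle is
   a coboundary; in degree 0 only the zero cochain is one. No signs are needed
   in characteristic 2. *)
Definition codiff (Y : topologicalType) n (c : cochain n Y) :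
    cochain n.+1 Y :=
  fun s => \sum_(i < n.+2) c (reindex s (lift i)).

Definition cocycle (Y : topologicalType) n (c : cochain n Y) :=
  codiff c = fun=> 0.

Definition coboundary (Y : topologicalType) n : cochain n Y -> Prop :=
  if n is n'.+1 then fun c => exists b : cochain n' Y, c = codiff b
  else fun c => c = fun=> 0.

(* The Alexander-Whitney product. *)
Definition cup (Y : topologicalType) p q (a : cochain p Y) (b : cochain q Y) :
    cochain (p + q) Y :=
  fun s => a (reindex s (fun i : 'I_p.+1 => inord i)) *
           b (reindex s (fun i : 'I_q.+1 => inord (p + i))).

Fixpoint cup_power (Y : topologicalType) (a : cochain 1 Y) (k : nat) :
    cochain k Y :=
  if k is k'.+1 then cup a (@cup_power Y a k') else fun=> 1.

Definition pullback (X Y : topologicalType) (w : continuousType X Y) n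
    (c : cochain n Y) : cochain n X :=
  fun s => c (w \o s : continuousType _ _).
End Simplex.

Arguments cup_power {R Y} a k.

Section Sphere.
Variable R : realType.

Definition sphere (n : nat) : set 'rV[R]_n.+1 :=
  [set x | \sum_i x ord0 i ^+ 2 = 1].

Definition zero_extend (n : nat) (x : set_type (@sphere n)) : nat -> R :=
  fun i => if (i <= n)%N then val x ord0 (inord i) else 0.

Definition infinite_sphere_space : topologicalType :=
  union_space zero_extend.

Lemma sphere_oppP n (x : set_type (@sphere n)) : (- val x) \in @sphere n.
Proof.
apply/mem_set; rewrite /sphere /= -[RHS](set_valP x).
by apply: eq_bigr => i _; rewrite mxE sqrrN.
Qed.

Definition sphere_opp n (x : set_type (@sphere n)) : set_type (@sphere n) :=
  exist _ (- val x) (sphere_oppP x).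

Lemma sphere_opp_continuous n : continuous (@sphere_opp n).
Proof.
apply: continuous_comp_initial; apply: matrix_continuous => i j.
under eq_fun do rewrite /= mxE.
move=> x; apply: continuousN.
have vx : {for x, continuous (@set_val _ (@sphere n))}.
  exact: initial_continuous.
exact: (continuous_comp vx (@coord_continuous R 1 n.+1 i j _)).
Qed.

Lemma zero_extend_opp n (x : set_type (@sphere n)) :
  zero_extend (sphere_opp x) = (fun i => - zero_extend x i).
Proof.
by apply/funext => i; rewrite /zero_extend /=; case: ifP; rewrite ?mxE ?oppr0.
Qed.

Lemma antipode_subproof (x : infinite_sphere_space) :
  exists n a, @zero_extend n a = (fun i => - sval x i).
Proof.
by case: x => z [n [a az]]; exists n, (sphere_opp a); rewrite zero_extend_opp az.
Qed.

Definition antipode (x : infinite_sphere_space) : infinite_sphere_space :=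
  exist _ (fun i => - sval x i) (antipode_subproof x).

Lemma antipodeK : involutive antipode.
Proof. by move=> x; apply: union_inj; apply/funext => i /=; rewrite opprK. Qed.

Lemma antipode_continuous : continuous antipode.
Proof.
apply: union_continuous => n.
have -> : antipode \o union_in zero_extend (i:=n) =
          union_in zero_extend (i:=n) \o @sphere_opp n.
  by apply/funext => x; apply: union_inj; rewrite /= zero_extend_opp.
move=> x; apply: continuous_comp; first exact: sphere_opp_continuous.
exact: union_in_continuous.
Qed.

Definition infinite_sphere : z2space :=
  Z2Space antipodeK antipode_continuous.

Definition infinite_projective_space : topologicalType :=
  orbit_space infinite_sphere.
End Sphere.

Section Realization.
Context (R : realType) (P : Type).
Variable le : P -> P -> Prop.

(* Repetitions are allowed: a degenerate chain gives a map that factors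
   through a nondegenerate simplex, so the space below is unchanged. *)
Record chain := Chain {
  chain_dim : nat;
  chain_elt :> 'I_chain_dim.+1 -> P;
  chain_mono : forall i j : 'I_chain_dim.+1,
    (i <= j)%N -> le (chain_elt i) (chain_elt j) }.

(* A point is given by its barycentric coordinates P -> R. *)
Definition barycentric (p : chain) (t : set_type (@simplex R (chain_dim p))) :
    P -> R :=
  fun q => \sum_(i | `[< p i = q >]) val t ord0 i.

Definition realization : topologicalType := union_space barycentric.
End Realization.

Section HomComplex.
Context (R : realType) (T H : graph).

(* The index set of the cells of Hom(T, H). *)
Record multihom := Multihom {
  mhom :> T -> set H;
  mhom_neq0 : forall x, mhom x !=set0;
  mhom_edge : forall x y, edge x y ->
    forall x' y', mhom x x' -> mhom y y' -> edge x' y' }.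

Lemma multihom_inj (eta eta' : multihom) : eta =1 eta' -> eta = eta'.
Proof.
case: eta eta' => [f f0 f1] [g g0 g1] /= /funext fg.
rewrite -{}fg in g0 g1 *; congr Multihom; exact: Prop_irrelevance.
Qed.

Definition multihom_le (eta eta' : multihom) :=
  forall x, eta x `<=` eta' x.

Definition hom_complex : topologicalType := @realization R multihom multihom_le.

Variable phi : graph_involution T.

Definition multihom_act (eta : multihom) : multihom :=
  @Multihom (eta \o phi) (fun x => mhom_neq0 eta (phi x))
    (fun x y xy => @mhom_edge eta _ _ (@invol_hom T phi x y xy)).

Lemma multihom_actK : involutive multihom_act.
Proof. by move=> eta; apply: multihom_inj => x /=; rewrite involK. Qed.

Lemma multihom_act_le eta eta' :
  multihom_le eta eta' -> multihom_le (multihom_act eta) (multihom_act eta').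
Proof. by move=> le_eta x; exact: le_eta. Qed.

Definition chain_act (p : chain multihom_le) : chain multihom_le :=
  Chain (fun i j ij => multihom_act_le (chain_mono (c := p) ij)).

Lemma barycentric_act p (t : set_type (@simplex R (chain_dim p))) :
  barycentric (p := chain_act p) t = barycentric t \o multihom_act.
Proof.
apply/funext => q /=; apply: eq_bigl => i /=.
by apply/asbool_equiv_eq; split=> [<-|->]; rewrite multihom_actK.
Qed.

Lemma hom_act_subproof (x : hom_complex) :
  exists p t, @barycentric R _ multihom_le p t = sval x \o multihom_act.
Proof.
by case: x => z [p [t tz]]; exists (chain_act p), t; rewrite barycentric_act tz.
Qed.

(* The point with coordinates x goes to the point whose coordinate at
   eta \o phi is that of x at eta; phi being an involution, this is
   precomposition of x with multihom_act. *)
Definition hom_act (x : hom_complex) : hom_complex :=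
  exist _ (sval x \o multihom_act) (hom_act_subproof x).

Lemma hom_actK : involutive hom_act.
Proof.
by move=> x; apply: union_inj; apply/funext => q /=; rewrite multihom_actK.
Qed.

Lemma hom_act_continuous : continuous hom_act.
Proof.
apply: union_continuous => p.
have -> : hom_act \o union_in (@barycentric R _ multihom_le) (i:=p) =
          union_in (@barycentric R _ multihom_le) (i:=chain_act p).
  by apply/funext => t; apply: union_inj; rewrite /= barycentric_act.
exact: (union_in_continuous (i := chain_act p)).
Qed.

Definition hom_z2space : z2space := Z2Space hom_actK hom_act_continuous.
End HomComplex.

(* When z represents the nontrivial class in H^1(RP^oo; Z/2), this cocycle
   represents varpi_1^k(X) = w^*(z^k), where w : X/Z_2 -> RP^oo is induced by
   the equivariant map u : X -> S^oo. Two choices of u give homotopic maps w,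
   hence the same class. *)
Definition stiefel_whitney_power (R : realType)
    (z : cochain R 1 (infinite_projective_space R)) (X : z2space)
    (u : z2map X (infinite_sphere R)) (k : nat) : cochain R k (orbit_space X) :=
  pullback (orbit_map u) (cup_power z k).

Arguments stiefel_whitney_power {R} z {X} u k.

(* Main.v *)
(* A colouring of G with n <= m colours gives an equivariant map
   f : Hom(T, G) -> Hom(T, K_m), and the class of v \o f is the pullback of the
   class of v. So it suffices that two equivariant maps u, u' : X -> S^oo give
   cohomologous powers. Spreading the coordinates of S^oo over the even, resp.
   the odd, indices yields a chain u, even u, odd u', u' in which neighbours
   are never antipodal, hence are joined by normalized segments. They form a
   homotopy of the orbit maps: continuity can be tested on compact pieces, and
   these land in a finite sphere. The cochain y |-> z (track of y) bounds the
   difference of the pulled back 1-cocycles. The Leibniz rule then carries this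
   over to the cup powers, so no prism operator is needed above degree 1. *)

Require Import Defs.
From mathcomp Require Import all_boot all_order all_algebra.
From mathcomp Require Import all_classical all_reals all_analysis.
From mathcomp Require Import zify.
Import Defs.

Set Implicit Arguments.
Unset Strict Implicit.
Unset Printing Implicit Defensive.

Import Order.TTheory GRing.Theory Num.Theory.
Import numFieldNormedType.Exports.

Local Open Scope classical_set_scope.
Local Open Scope ring_scope.

(** * Singular cochains modulo 2: Leibniz rule, cup powers, pullbacks *)

Lemma addF2_self (x : 'F_2) : x + x = 0.
Proof. by apply: addrr_pchar2; exact: pchar_Fp. Qed.

Lemma addF2_eq (x y : 'F_2) : x + y = 0 -> x = y.
Proof. by move=> xy; rewrite -[x]addr0 -(addF2_self y) addrA xy add0r. Qed.

Lemma affine_comp (R : realType) l m n (f : 'I_m.+1 -> 'I_n.+1)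
    (g : 'I_l.+1 -> 'I_m.+1) (t : 'rV[R]_l.+1) :
  affine f (affine g t) = affine (f \o g) t.
Proof.
apply/rowP => j; rewrite !mxE.
under eq_bigr do rewrite mxE.
rewrite [RHS](partition_big g (fun i => f i == j)) //=.
apply: eq_bigr => i /eqP fi; apply: eq_bigl => k.
by case: eqP => [->|]; rewrite ?andbF // fi eqxx.
Qed.

Lemma affine_id (R : realType) n (t : 'rV[R]_n.+1) : affine id t = t.
Proof. by apply/rowP => j; rewrite mxE big_pred1_eq. Qed.

Section Cochains.
Context {R : realType}.
Implicit Types X Y : topologicalType.

Lemma simplex_map_comp l m n (f : 'I_m.+1 -> 'I_n.+1)
    (g : 'I_l.+1 -> 'I_m.+1) (t : set_type (@simplex R l)) :
  simplex_map R f (simplex_map R g t) = simplex_map R (f \o g) t.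
Proof. by apply: val_inj; exact: affine_comp. Qed.

Lemma simplex_map_id n (t : set_type (@simplex R n)) : simplex_map R id t = t.
Proof. by apply: val_inj; exact: affine_id. Qed.

Lemma reindex_comp Y l m n (s : singular R n Y) (f : 'I_m.+1 -> 'I_n.+1)
    (g : 'I_l.+1 -> 'I_m.+1) : reindex (reindex s f) g = reindex s (f \o g).
Proof.
by apply/continuousEP => t /=; rewrite simplex_map_comp.
Qed.

Lemma eq_reindex Y m n (s : singular R n Y) (f g : 'I_m.+1 -> 'I_n.+1) :
  f =1 g -> reindex s f = reindex s g.
Proof. by move=> /funext ->. Qed.

Lemma codiff_add Y n (a b : cochain R n Y) :
  codiff (fun s => a s + b s) = (fun s => codiff a s + codiff b s).
Proof. by apply/funext => s; rewrite /codiff big_split. Qed.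

(** Faces of a simplex are compared by the numbers of their vertices; the bound [ltn_ord j] keeps
    each [inord] in range. *)
Ltac same_vertices :=
  apply: eq_reindex => j; apply: val_inj;
  rewrite /= /bump !inordK /=; have := ltn_ord j; lia.

(** Leibniz rule. Left factors occur only in degrees 0 and 1, where the degrees of the terms agree
    by computation; for a variable p, [p + n.+1] and [(p + n).+1] would not be convertible. *)
Lemma codiff_cup0 Y n (b : cochain R 0 Y) (c : cochain R n Y) :
  codiff (cup b c) =
  (fun s => cup (codiff b) c s + cup b (codiff c) s) :> cochain R n.+1 Y.
Proof.
apply/funext => s; rewrite /codiff /cup.
rewrite [in RHS]big_ord_recl [in RHS]big_ord1 mulr_sumr.
rewrite big_ord_recl [X in _ = _ + X]big_ord_recl.
have face0 : reindex (reindex s (lift ord0))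
    (fun j : 'I_n.+1 => inord (0 + j)) =
  reindex s (fun j : 'I_n.+1 => inord (1 + j)).
  by rewrite reindex_comp; same_vertices.
have face0' : reindex (reindex s (fun j : 'I_n.+2 => inord (0 + j)))
    (lift ord0) =
  reindex s (fun j : 'I_n.+1 => inord (1 + j)).
  by rewrite reindex_comp; same_vertices.
have front1 : reindex (reindex s (fun i : 'I_2 => inord i)) (lift ord0) =
  reindex (reindex s (lift ord0)) (fun i : 'I_1 => inord i).
  by rewrite !reindex_comp; same_vertices.
have front0 : reindex (reindex s (fun i : 'I_2 => inord i))
    (lift (lift ord0 ord0)) =
  reindex s (fun i : 'I_1 => inord i).
  by rewrite !reindex_comp; same_vertices.
rewrite face0 face0' front1 front0 mulrDl -!addrA; congr (_ + _).
(* The product of b on vertex 0 and c on the face without vertex 0 comes from both [codiff b] and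
   [codiff c], and cancels. *)
rewrite addrA addF2_self add0r; apply: eq_bigr => -[i /= i_lt] _.
rewrite !reindex_comp.
congr (b _ * c _); same_vertices.
Qed.

Lemma codiff_cup1 Y n (a : cochain R 1 Y) (c : cochain R n Y) :
  codiff (cup a c) =
  (fun s => cup (codiff a) c s + cup a (codiff c) s) :> cochain R n.+2 Y.
Proof.
apply/funext => s; rewrite /codiff /cup.
rewrite [LHS]big_ord_recl [X in _ + X = _]big_ord_recl.
rewrite [X in _ = X * _ + _]big_ord_recl [X in _ = (_ + X) * _ + _]big_ord_recl.
rewrite big_ord1 mulr_sumr.
rewrite [X in _ = _ + X]big_ord_recl.
have back0 : reindex (reindex s (lift ord0))
    (fun j : 'I_n.+1 => inord (1 + j)) =
  reindex s (fun j : 'I_n.+1 => inord (2 + j)).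
  by rewrite reindex_comp; same_vertices.
have back1 : reindex (reindex s (lift (lift ord0 ord0)))
    (fun j : 'I_n.+1 => inord (1 + j)) =
  reindex s (fun j : 'I_n.+1 => inord (2 + j)).
  by rewrite reindex_comp; same_vertices.
have back1' : reindex (reindex s (fun j : 'I_n.+2 => inord (1 + j)))
    (lift ord0) =
  reindex s (fun j : 'I_n.+1 => inord (2 + j)).
  by rewrite reindex_comp; same_vertices.
have front0 : reindex (reindex s (fun i : 'I_3 => inord i)) (lift ord0) =
  reindex (reindex s (lift ord0)) (fun i : 'I_2 => inord i).
  by rewrite !reindex_comp; same_vertices.
have front1 : reindex (reindex s (fun i : 'I_3 => inord i))
    (lift (lift ord0 ord0)) =
  reindex (reindex s (lift (lift ord0 ord0))) (fun i : 'I_2 => inord i).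
  by rewrite !reindex_comp; same_vertices.
have front2 : reindex (reindex s (fun i : 'I_3 => inord i))
     (lift (lift ord0 (lift ord0 ord0))) =
  reindex s (fun i : 'I_2 => inord i).
  by rewrite !reindex_comp; same_vertices.
rewrite back0 back1 back1' front0 front1 front2 !mulrDl -!addrA.
congr (_ + (_ + _)).
(* Here the cancelling pair is a on the edge 01 times c on the vertices from 2 on. *)
rewrite addrA addF2_self add0r; apply: eq_bigr => -[i /= i_lt] _.
rewrite !reindex_comp.
congr (a _ * c _); same_vertices.
Qed.

Lemma cocycle_cup1 Y n (a : cochain R 1 Y) (c : cochain R n Y) :
  cocycle a -> cocycle c -> cocycle (cup a c).
Proof.
move=> az cz; apply/funext => s; rewrite codiff_cup1 az cz /cup.
by rewrite mul0r mulr0 addr0.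
Qed.

Lemma cocycle_cup_power Y (a : cochain R 1 Y) k :
  cocycle a -> cocycle (cup_power a k).
Proof.
move=> az; elim: k => [|k IHk]; last exact: cocycle_cup1.
by apply/funext => s; rewrite /codiff big_ord_recl big_ord1 addF2_self.
Qed.

(** Modulo 2 the sum is the difference. *)
Definition cohomologous Y n (a b : cochain R n Y) :=
  coboundary (fun s => a s + b s).

Lemma coboundary_add Y n (a b : cochain R n Y) :
  coboundary a -> coboundary b -> coboundary (fun s => a s + b s).
Proof.
case: n a b => [|n] a b /=.
  by move=> -> ->; apply/funext => s; rewrite addr0.
by move=> [a' ->] [b' ->]; exists (fun s => a' s + b' s); rewrite codiff_add.
Qed.

Lemma cohomologous_coboundary Y n (a b : cochain R n Y) :
  cohomologous a b -> coboundary b -> coboundary a.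
Proof.
move=> ab b0; have := coboundary_add ab b0.
by congr coboundary; apply/funext => s; rewrite -addrA addF2_self addr0.
Qed.

Lemma cohomologous_trans Y n (a b c : cochain R n Y) :
  cohomologous a b -> cohomologous b c -> cohomologous a c.
Proof.
move=> ab bc; have := coboundary_add ab bc.
congr coboundary; apply/funext => s.
by rewrite -addrA (addrA (b s)) addF2_self add0r.
Qed.

Lemma cohomologous_sym Y n (a b : cochain R n Y) :
  cohomologous a b -> cohomologous b a.
Proof.
by congr coboundary; apply/funext => s; rewrite addrC.
Qed.

(** Induction on a^(k+1) + b^(k+1) = a (a^k + b^k) + (a + b) b^k. If a^k + b^k bounds d and a + b
    bounds e, the two terms bound a d and e b^k, since a and b^k are cocycles. *)
Lemma cohomologous_cup_power Y (a b : cochain R 1 Y) k :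
  cocycle a -> cocycle b -> cohomologous a b ->
  cohomologous (cup_power a k) (cup_power b k).
Proof.
move=> az bz [e abe]; have aE s : a s = b s + codiff e s.
  by rewrite -abe addrCA addF2_self addr0.
elim: k => [|k IHk].
  by apply/funext => s /=; rewrite addF2_self.
have bkz := cocycle_cup_power k bz.
have [d dE] :
    coboundary (fun s => cup a (cup_power a k) s + cup a (cup_power b k) s).
  (* In degree 0 cohomologous means equal, so there is no d to multiply; the zero cochain serves
     instead. *)
  case: k IHk {bkz} => [|k].
    move=> ab0; exists (fun=> 0); apply/funext => s.
    by rewrite /codiff big1 // /cup /= addF2_self.
  move=> [d dE]; exists (cup a d); apply/funext => s.
  rewrite (codiff_cup1 a d) az -dE /cup mul0r add0r mulrDr //.
exists (fun s => d s + cup e (cup_power b k) s); rewrite codiff_add -dE.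
apply/funext => s; rewrite (codiff_cup0 e) bkz.
rewrite /= /cup mulr0 addr0 -addrA -mulrDl; congr (_ + _ * _).
by rewrite aE -addrA addF2_self addr0.
Qed.

Lemma pullback_reindex X Y (w : continuousType X Y) m n (s : singular R n X)
    (f : 'I_m.+1 -> 'I_n.+1) :
  (w \o reindex s f : continuousType _ _) =
  reindex (w \o s : continuousType _ _) f.
Proof. exact/continuousEP. Qed.

Lemma pullback_codiff X Y (w : continuousType X Y) n (c : cochain R n Y) :
  pullback w (codiff c) = codiff (pullback w c).
Proof.
apply/funext => s; rewrite /pullback /codiff; apply: eq_bigr => i _.
by rewrite pullback_reindex.
Qed.

Lemma pullback_coboundary X Y (w : continuousType X Y) n (c : cochain R n Y) :
  coboundary c -> coboundary (pullback w c).
Proof.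
case: n c => [|n] c /=; first by move=> ->.
by move=> [b ->]; exists (pullback w b); exact: pullback_codiff.
Qed.

Lemma pullback_cocycle X Y (w : continuousType X Y) n (c : cochain R n Y) :
  cocycle c -> cocycle (pullback w c).
Proof. by rewrite /cocycle -pullback_codiff => ->. Qed.

Lemma pullback_cup_power X Y (w : continuousType X Y) (z : cochain R 1 Y) k :
  pullback w (cup_power z k) = cup_power (pullback w z) k.
Proof.
elim: k => [|k IHk] //=; rewrite -IHk.
by apply/funext => s; rewrite /cup /pullback !pullback_reindex.
Qed.
End Cochains.

(** * Homotopy invariance of classes of degree 1 *)

Section Homotopy.
Context {R : realType} {X Y : topologicalType}.
Variable h : continuousType (X * set_type (@simplex R 1))%type Y.

Lemma prism_continuous p n (s : singular R p X) (f : 'I_n.+1 -> 'I_p.+1)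
    (g : 'I_n.+1 -> 'I_2) :
  continuous (fun t => h (s (simplex_map R f t), simplex_map R g t)).
Proof.
move=> t; apply: (@continuous_comp _ _ _
  (fun t => (s (simplex_map R f t), simplex_map R g t)) h); last exact: cts_fun.
exact: (cvg_pair (@cts_fun _ _ (reindex s f) t)
  (@simplex_map_continuous R _ _ g t)).
Qed.

(** The affine simplex of Delta^p x Delta^1 with vertices (f i, g i), carried to Y by s and h. With
    Delta^1 as time interval, the triangles over a path, their edges and the tracks of points all
    have this form. *)
Definition prism p n (s : singular R p X) (f : 'I_n.+1 -> 'I_p.+1)
    (g : 'I_n.+1 -> 'I_2) : singular R n Y :=
  mkcts (@prism_continuous p n s f g).

Lemma reindex_prism p m n (s : singular R p X) (f : 'I_n.+1 -> 'I_p.+1)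
    (g : 'I_n.+1 -> 'I_2) (e : 'I_m.+1 -> 'I_n.+1) :
  reindex (prism s f g) e = prism s (f \o e) (g \o e).
Proof.
apply/continuousEP => t; congr (h (s _, _)); exact: simplex_map_comp.
Qed.

Lemma prism_reindex p q n (s : singular R p X) (e : 'I_q.+1 -> 'I_p.+1)
    (f : 'I_n.+1 -> 'I_q.+1) (g : 'I_n.+1 -> 'I_2) :
  prism (reindex s e) f g = prism s (e \o f) g.
Proof.
apply/continuousEP => t; congr (h (s _, _)); exact: simplex_map_comp.
Qed.

Lemma eq_prism p n (s : singular R p X) (f f' : 'I_n.+1 -> 'I_p.+1)
    (g g' : 'I_n.+1 -> 'I_2) :
  f =1 f' -> g =1 g' -> prism s f g = prism s f' g'.
Proof. by move=> /funext -> /funext ->. Qed.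

(** The constant vertex map sends every t to vertex i of Delta^1, so this is the time i end of h. *)
Definition homotopy_end (w : continuousType X Y) (i : 'I_2) :=
  forall x t, h (x, simplex_map R (fun _ : 'I_2 => i) t) = w x.

(* The square over a path is cut into two triangles along its diagonal. *)
Lemma homotopy_cohomologous (w0 w1 : continuousType X Y) (z : cochain R 1 Y) :
  homotopy_end w0 ord0 -> homotopy_end w1 ord_max -> cocycle z ->
  cohomologous (pullback w0 z) (pullback w1 z).
Proof.
move=> h0 h1 zz; exists (fun s => z (prism s (fun=> ord0) id)).
apply/funext => s; rewrite /codiff big_ord_recl big_ord1 !prism_reindex.
(* On vertices 0, 1, 2 the values are 0, 0, 1 for [lo] and 0, 1, 1 for [up]; the pairs (up, lo) and
   (lo, up) are the two triangles, and omitting vertex 1 gives their common diagonal. *)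
pose lo (i : 'I_3) : 'I_2 := inord i.-1.
pose up (i : 'I_3) : 'I_2 := inord (minn i 1).
have codiff3 (f g : 'I_3 -> 'I_2) :
    z (prism s (f \o lift ord0) (g \o lift ord0)) +
    z (prism s (f \o lift (lift ord0 ord0)) (g \o lift (lift ord0 ord0))) +
    z (prism s (f \o lift (lift ord0 (lift ord0 ord0)))
               (g \o lift (lift ord0 (lift ord0 ord0)))) = 0.
  have := congr1 (@^~ (prism s f g)) zz; rewrite /codiff.
  by rewrite 2!big_ord_recl big_ord1 !reindex_prism addrA.
have := codiff3 up lo; have := codiff3 lo up.
have fI2 (i j : 'I_2) : i = j :> nat -> i = j by exact: val_inj.
have lo0 : lo \o lift ord0 =1 id.
  by case=> [[|[|[]]]//= ?]; apply: fI2; rewrite /= inordK.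
have lo1 : lo \o lift (lift ord0 ord0) =1 id.
  by case=> [[|[|[]]]//= ?]; apply: fI2; rewrite /= inordK.
have lo2 : lo \o lift (lift ord0 (lift ord0 ord0)) =1 fun=> ord0.
  by case=> [[|[|[]]]//= ?]; apply: fI2; rewrite /= inordK.
have up0 : up \o lift ord0 =1 fun=> ord_max.
  by case=> [[|[|[]]]//= ?]; apply: fI2; rewrite /= inordK.
have up1 : up \o lift (lift ord0 ord0) =1 id.
  by case=> [[|[|[]]]//= ?]; apply: fI2; rewrite /= inordK.
have up2 : up \o lift (lift ord0 (lift ord0 ord0)) =1 id.
  by case=> [[|[|[]]]//= ?]; apply: fI2; rewrite /= inordK.
rewrite (eq_prism s lo0 up0) (eq_prism s lo1 up1) (eq_prism s lo2 up2).
rewrite (eq_prism s up0 lo0) (eq_prism s up1 lo1) (eq_prism s up2 lo2).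
have -> : prism s id (fun=> ord0) = (w0 \o s : continuousType _ _).
  apply/continuousEP => t; have := h0 (s t) t; congr (h (s _, _) = _).
  by rewrite simplex_map_id.
have -> : prism s id (fun=> ord_max) = (w1 \o s : continuousType _ _).
  apply/continuousEP => t; have := h1 (s t) t; congr (h (s _, _) = _).
  by rewrite simplex_map_id.
rewrite [lift ord0 \o _](_ : _ = fun=> ord_max); last first.
  by apply/funext => j; apply: fI2.
rewrite [lift (lift ord0 ord0) \o _](_ : _ = fun=> ord0); last first.
  by apply/funext => j; apply: fI2.
(* The end at w1 is the diagonal plus the track of the initial point, the end at w0 is the track of
   the final point plus the diagonal. In the sum the diagonal cancels. *)
rewrite -addrA => /addF2_eq w1E; rewrite addrC => /addF2_eq w0E.
rewrite /pullback w0E w1E -addrA; congr (_ + _).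
by rewrite addrA addF2_self add0r.
Qed.
End Homotopy.

(** * Compact simplices and compactly generated spaces *)

Lemma set_type_compact (X : topologicalType) (A : set X) :
  compact A -> compact [set: set_type A].
Proof.
move=> Ac F FF _.
(* The filter is pushed forward to X; a cluster point in A is one in the subtype, whose open sets
   are traces of open sets of X. *)
have FA : (set_val @ F) A by apply: (@filterE _ F _) => a; exact: set_valP.
have [p [Ap clp]] := Ac _ (fmap_proper_filter set_val FF) FA.
exists (exist _ p (mem_set Ap)); split=> // B U FB.
rewrite nbhsE => -[V [ [W oW WV] Vp] VU].
have Wp : W p by move: Vp; rewrite -WV.
have FB' : (set_val @ F) (set_val @` B).
  by apply: (@filterS _ F _ B) => // b Bb; exists b.
have [q [ [b Bb <-] Wq]] := clp _ _ FB' (open_nbhs_nbhs (conj oW Wp)).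
by exists b; split=> //; by apply: VU; rewrite -WV.
Qed.

Lemma simplex_compact (R : realType) n : compact [set: set_type (@simplex R n)].
Proof.
apply: set_type_compact; apply: bounded_closed_compact.
  exists 1; split; first exact: real1.
  move=> M M1 t [t0 t1]; rewrite /Num.norm /= mx_normrE.
  apply: bigmax_le => [|[i j] _ /=]; first exact: le_trans (ltW M1).
  rewrite ord1 ger0_norm // (le_trans _ (ltW M1)) // -t1 (bigD1 j) //=.
  by rewrite lerDl sumr_ge0.
have -> : @simplex R n =
    (\bigcap_i [set t : 'rV[R]_n.+1 | 0 <= t ord0 i]) `&`
    [set t : 'rV[R]_n.+1 | \sum_i t ord0 i = 1].
  by apply/seteqP; split=> t [t0 t1]; split=> // i; [move=> _|]; exact: t0.
apply: closedI.
  apply: closed_bigI => i _.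
  apply: (@preimage_closed _ _ (fun t : 'rV[R]_n.+1 => t ord0 i)
    [set x | 0 <= x]).
    by move=> t _; exact: coord_continuous.
  exact: closed_ge.
apply: (@preimage_closed _ _ (fun t : 'rV[R]_n.+1 => \sum_i t ord0 i) [set 1]).
  move=> t _; apply: continuous_big => [|i _]; first exact: add_continuous.
  exact: coord_continuous.
exact: closed_eq.
Qed.

(** Phrased through compact probes because only over a compact domain is a map to S^oo known to land
    in a finite sphere. *)
Definition compactly_generated (X : topologicalType) :=
  forall (Z : topologicalType) (f : X -> Z),
  (forall (K : topologicalType) (g : K -> X), compact [set: K] ->
    continuous g -> continuous (f \o g)) ->
  continuous f.

Lemma union_space_compactly_generated (I : Type) (A : I -> topologicalType)
    (Z : Type) (j : forall i, A i -> Z) :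
  (forall i, compact [set: A i]) -> compactly_generated (union_space j).
Proof.
move=> Ac W f fc; apply: union_continuous => i; apply: fc => //.
exact: union_in_continuous.
Qed.

(** * The infinite sphere: supports, coordinates, compact images *)

Section InfiniteSphere.
Context {R : realType}.
Implicit Types (x y : infinite_sphere R) (f : nat -> R).

Lemma continuous_mul (A : topologicalType) (F G : A -> R) :
  continuous F -> continuous G -> continuous (fun a => F a * G a).
Proof. by move=> Fc Gc a; exact: (continuousM (Fc a) (Gc a)). Qed.

Lemma continuous_add (A : topologicalType) (F G : A -> R) :
  continuous F -> continuous G -> continuous (fun a => F a + G a).
Proof. by move=> Fc Gc a; exact: (continuousD (Fc a) (Gc a)). Qed.

Definition supported N f := forall i, (N < i)%N -> f i = 0.

(** A sum over the support, which names no bound N, as N varies with the point; [totalE] evaluates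
    it once a bound is known. *)
Definition total f := \sum_(i \in [set: nat]) f i.

Lemma totalE N f : supported N f -> total f = \sum_(i < N.+1) f i.
Proof.
move=> fN; rewrite fsbig_ord; apply/esym/fsbig_widen => // i [_ /= /negP].
by rewrite -ltnNge ltnS => /fN.
Qed.

Lemma supported_sq N f : supported N f -> supported N (fun i => f i ^+ 2).
Proof. by move=> fN i /fN ->; rewrite expr0n. Qed.

Lemma sphere_supported x : exists N, supported N (sval x).
Proof.
case: (unionP x) => N [a <-]; exists N => i Ni.
by rewrite /= /zero_extend leqNgt Ni.
Qed.

Lemma sphere_total x : total (fun i => sval x i ^+ 2) = 1.
Proof.
case: (unionP x) => N [a <-]; rewrite (@totalE N); last first.
  by apply: supported_sq => i Ni; rewrite /= /zero_extend leqNgt Ni.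
rewrite -(set_valP a); apply: eq_bigr => i _.
by rewrite /= /zero_extend -ltnS ltn_ord inord_val.
Qed.

Lemma truncate_sphere N f : supported N f -> total (fun i => f i ^+ 2) = 1 ->
  (\row_(i < N.+1) f i) \in @sphere R N.
Proof.
move=> fN f1; apply/mem_set; rewrite /sphere /= -f1 (totalE (supported_sq fN)).
by apply: eq_bigr => i _; rewrite mxE.
Qed.

Definition truncate N f (fN : supported N f)
    (f1 : total (fun i => f i ^+ 2) = 1) : set_type (@sphere R N) :=
  exist _ (\row_(i < N.+1) f i) (truncate_sphere fN f1).

Lemma zero_extend_truncate N f (fN : supported N f)
    (f1 : total (fun i => f i ^+ 2) = 1) :
  zero_extend (truncate fN f1) = f.
Proof.
apply/funext => i; rewrite /zero_extend.
by case: leqP => [iN|/fN//]; rewrite /= mxE inordK.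
Qed.

Lemma zero_extend_ex N f : supported N f -> total (fun i => f i ^+ 2) = 1 ->
  exists n a, @zero_extend R n a = f.
Proof.
move=> fN f1; by exists N, (truncate fN f1); exact: zero_extend_truncate.
Qed.

Lemma sphere_coord_continuous i : continuous (fun x => sval x i).
Proof.
apply: union_continuous => N; rewrite /comp /= /zero_extend.
case: leqP => iN; last exact: cst_continuous.
move=> a; have va : {for a, continuous (@set_val _ (@sphere R N))}.
  exact: initial_continuous.
exact: (continuous_comp va (@coord_continuous R 1 N.+1 ord0 (inord i) _)).
Qed.

(** In the final topology continuous coordinates are not enough. A uniform bound on the supports
    makes g factor through a finite sphere, where they are. *)
Lemma continuous_into_sphere (A : topologicalType)
    (g : A -> infinite_sphere R) N :
  (forall a, supported N (sval (g a))) ->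
  (forall i, continuous (fun a => sval (g a) i)) -> continuous g.
Proof.
move=> gN gc.
pose g' a : set_type (@sphere R N) :=
  truncate (gN a) (sphere_total (g a)).
have -> : g = union_in (@zero_extend R) (i := N) \o g'.
  by apply/funext => a; apply: union_inj; rewrite /= zero_extend_truncate.
move=> a; apply: continuous_comp; last exact: union_in_continuous.
apply: continuous_comp_initial; apply: matrix_continuous => i j.
by under eq_fun do rewrite /= mxE; exact: gc.
Qed.

(** On each finite sphere the sum is finite, so the weights may grow arbitrarily fast. *)
Lemma weighted_total_continuous (c : nat -> R) :
  continuous (fun x => total (fun i => c i * `|sval x i|)).
Proof.
apply: union_continuous => N.
have -> : (fun x => total (fun i => c i * `|sval x i|)) \o
    union_in (@zero_extend R) (i := N) =
    (fun a => \sum_(i < N.+1) c i * `|sval (union_in (@zero_extend R) a) i|).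
  apply/funext => a; rewrite /= (@totalE N) // => i Ni.
  by rewrite /zero_extend leqNgt Ni normr0 mulr0.
apply: continuous_big => [|i _]; first exact: add_continuous.
apply: (@continuous_mul _ (fun=> c i)); first exact: cst_continuous.
move=> a.
apply: (@continuous_comp _ _ _ (fun a => sval (union_in (@zero_extend R) a) i)).
  apply: (@continuous_comp _ _ _ (union_in (@zero_extend R) (i := N))
    (fun x => sval x i)).
    exact: union_in_continuous.
  exact: sphere_coord_continuous.
exact: norm_continuous.
Qed.

(* Otherwise some weights would make the weighted l^1 norm, which is
   continuous, unbounded on the compact image. *)
Lemma compact_supported (K : topologicalType) (g : K -> infinite_sphere R) :
  compact [set: K] -> continuous g ->
  exists N, forall a, supported N (sval (g a)).
Proof.
move=> Kc gc; apply: contrapT => nosupp.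
pose P i a := sval (g a) i != 0.
(* If coordinate i is nonzero somewhere, its weight makes the weighted coordinate equal to i at some
   point. Weights are non-negative, so a single term bounds the total from below. *)
have /choice[c cP] : forall i, exists ci : R, 0 <= ci /\
    ((exists a, P i a) -> exists a, ci * `|sval (g a) i| = i%:R).
  move=> i; have [[a Pa]|noa] := pselect (exists a, P i a).
    exists (i%:R / `|sval (g a) i|); split; first by rewrite divr_ge0.
    by move=> _; exists a; rewrite divfK // normr_eq0.
  by exists 0; split.
pose W a := total (fun i => c i * `|sval (g a) i|).
have Wc : continuous W.
  move=> a; apply: (@continuous_comp _ _ _ g
    (fun x => total (fun i => c i * `|sval x i|))).
    exact: gc.
  exact: weighted_total_continuous.
have /compact_bounded[M [_ MW]] : compact (W @` setT).
  by apply: continuous_compact => //; exact: continuous_subspaceT.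
(* [compact_bounded] bounds W by any number above M, here |M| + 1; a nonzero coordinate i beyond
   this truncation would force W to reach i > |M| + 1. *)
apply: nosupp; exists (Num.truncn (`|M| + 1)) => a i Mi.
apply: contrapT => /eqP ai.
have [c0 /(_ (ex_intro _ a ai)) [b cb]] := cP i.
have : `|W b| <= `|M| + 1.
  by apply: MW; [rewrite ltr_pwDr // ler_norm|exists b].
have iW : i%:R <= W b.
  have [N gN] := sphere_supported (g b).
  rewrite -cb /W (@totalE (maxn N i)); last first.
    by move=> j; rewrite gtn_max => /andP[/gN -> _]; rewrite normr0 mulr0.
  have iN : (i < (maxn N i).+1)%N by rewrite ltnS leq_maxr.
  rewrite (bigD1 (Ordinal iN)) //= lerDl sumr_ge0 // => j _.
  by rewrite mulr_ge0 //; have [] := cP j.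
move=> /(le_trans (ler_norm _))/(le_trans iW); apply/negP; rewrite -ltNge.
have Mi' : (Num.truncn (`|M| + 1)).+1%:R <= i%:R :> R by rewrite ler_nat.
by apply: lt_le_trans Mi'; rewrite truncnS_gt // addr_ge0.
Qed.

End InfiniteSphere.

(** * Normalized segments between non-antipodal points *)

Section Segment.
Context {R : realType}.
Implicit Types (x y : infinite_sphere R) (t : set_type (@simplex R 1)).

Definition segment x y t (i : nat) : R :=
  val t ord0 ord0 * sval x i + val t ord0 ord_max * sval y i.

Definition normalize (f : nat -> R) (i : nat) : R :=
  f i / Num.sqrt (total (fun i => f i ^+ 2)).

Lemma segment_supported x y t N :
  supported N (sval x) -> supported N (sval y) -> supported N (segment x y t).
Proof.
by move=> xN yN i Ni; rewrite /segment xN ?yN // !mulr0 addr0.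
Qed.

(** If the combination vanishes, then t_0 x = - t_1 y. Comparing norms gives t_0 = t_1, which is
    nonzero as the two add up to 1, so x = - y. *)
Lemma segment_gt0 x y t : x <> flip y ->
  0 < total (fun i => segment x y t i ^+ 2).
Proof.
move=> xy; have [t0 t1] := set_valP t.
have [N1 xN1] := sphere_supported x; have [N2 yN2] := sphere_supported y.
pose N := maxn N1 N2.
have xN : supported N (sval x).
  by move=> i; rewrite gtn_max => /andP[/xN1].
have yN : supported N (sval y).
  by move=> i; rewrite gtn_max => /andP[_ /yN2].
have sN := segment_supported t xN yN.
rewrite (totalE (supported_sq sN)) lt_def sumr_ge0 ?andbT; last first.
  by move=> i _; exact: sqr_ge0.
apply/eqP => /eqP; rewrite psumr_eq0 => [/allP s0|i _]; last exact: sqr_ge0.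
have sE i : val t ord0 ord0 * sval x i = - (val t ord0 ord_max * sval y i).
  apply/eqP; rewrite -addr_eq0; have [iN|/sN/eqP//] := leqP i N.
  have := s0 (inord i) (mem_index_enum _).
  by rewrite sqrf_eq0 inordK.
have sqE (c : R) (z : infinite_sphere R) : supported N (sval z) ->
    \sum_(i < N.+1) (c * sval z i) ^+ 2 = c ^+ 2.
  move=> zN; under eq_bigr do rewrite exprMn.
  by rewrite -mulr_sumr -(totalE (supported_sq zN)) sphere_total mulr1.
have t01 : val t ord0 ord0 = val t ord0 ord_max.
  apply/eqP; rewrite -(eqrXn2 (isT : 0 < 2)%N) // -(sqE _ x xN) -(sqE _ y yN).
  by apply/eqP; apply: eq_bigr => i _; rewrite sE sqrrN.
have tn0 : val t ord0 ord_max != 0.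
  apply/eqP => t1E; move: t1; rewrite big_ord_recl big_ord1.
  rewrite [lift _ _](_ : _ = ord_max); last exact: val_inj.
  by rewrite t01 t1E addr0 => /eqP; rewrite eq_sym oner_eq0.
apply: xy; apply: union_inj; apply/funext => i /=.
by apply: (mulfI tn0); rewrite mulrN -sE t01.
Qed.

Lemma normalize_supported f N : supported N f -> supported N (normalize f).
Proof. by move=> fN i Ni; rewrite /normalize fN // mul0r. Qed.

Lemma normalize_total f N : supported N f -> 0 < total (fun i => f i ^+ 2) ->
  total (fun i => normalize f i ^+ 2) = 1.
Proof.
move=> fN f0; rewrite (totalE (supported_sq (normalize_supported fN))).
under eq_bigr do rewrite expr_div_n sqr_sqrtr ?(ltW f0) //.
by rewrite -mulr_suml -(totalE (supported_sq fN)) divff // gt_eqF.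
Qed.

Lemma sphere_segment_subproof x y t : x <> flip y ->
  exists n a, @zero_extend R n a = normalize (segment x y t).
Proof.
move=> xy; have [N1 xN1] := sphere_supported x.
have [N2 yN2] := sphere_supported y; pose N := maxn N1 N2.
have sN : supported N (segment x y t).
  apply: segment_supported => i; rewrite gtn_max => /andP[N1i N2i].
    exact: xN1.
  exact: yN2.
apply: (zero_extend_ex (normalize_supported sN)).
by apply: (normalize_total sN); exact: segment_gt0.
Qed.

Definition sphere_segment x y (xy : x <> flip y) t : infinite_sphere R :=
  exist _ (normalize (segment x y t)) (sphere_segment_subproof t xy).

Lemma simplex_map_constE (i j : 'I_2) t :
  val (simplex_map R (fun _ : 'I_2 => i) t) ord0 j = (j == i)%:R.
Proof.
have [_ t1] := set_valP t; rewrite /= mxE eq_sym.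
have [_|_] := eqVneq i j; first exact: t1.
exact: big_pred0_eq.
Qed.

Lemma sphere_segment0 x y (xy : x <> flip y) t :
  sphere_segment xy (simplex_map R (fun _ : 'I_2 => ord0) t) = x.
Proof.
have sE : segment x y (simplex_map R (fun _ : 'I_2 => ord0) t) = sval x.
  by apply/funext => i; rewrite /segment !simplex_map_constE mul1r mul0r addr0.
apply: union_inj; apply/funext => i.
by rewrite /= /normalize sE sphere_total sqrtr1 divr1.
Qed.

Lemma sphere_segment1 x y (xy : x <> flip y) t :
  sphere_segment xy (simplex_map R (fun _ : 'I_2 => ord_max) t) = y.
Proof.
have sE : segment x y (simplex_map R (fun _ : 'I_2 => ord_max) t) = sval y.
  by apply/funext => i; rewrite /segment !simplex_map_constE mul1r mul0r add0r.
apply: union_inj; apply/funext => i.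
by rewrite /= /normalize sE sphere_total sqrtr1 divr1.
Qed.

(** This lets segments descend to orbits. Giving the flipped ends by equations leaves the proofs
    [xy] and [xy'] arbitrary. *)
Lemma sphere_segment_flip x y x' y' (xy : x <> flip y) (xy' : x' <> flip y') t :
  x' = flip x -> y' = flip y ->
  sphere_segment xy' t = flip (sphere_segment xy t).
Proof.
move=> x'E y'E; have sE : segment x' y' t = fun i => - segment x y t i.
  by apply/funext => i; rewrite x'E y'E /segment /= !mulrN opprD.
apply: union_inj; apply/funext => i.
rewrite /= /normalize sE mulNr; congr (- (_ / Num.sqrt (total _))).
by apply/funext => j; rewrite sqrrN.
Qed.

(** Compactness bounds the supports of g and g' uniformly, which reduces the claim to coordinates;
    there the normalizing denominator is continuous and nonzero. *)
Lemma sphere_segment_continuous (K : topologicalType)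
    (g g' : K -> infinite_sphere R) (gg' : forall a, g a <> flip (g' a)) :
  compact [set: K] -> continuous g -> continuous g' ->
  continuous (fun p : K * set_type (@simplex R 1) =>
    sphere_segment (gg' p.1) p.2).
Proof.
move=> Kc gc g'c.
have [N1 gN1] := compact_supported Kc gc.
have [N2 gN2] := compact_supported Kc g'c.
pose N := maxn N1 N2.
have sN p : supported N (segment (g p.1) (g' p.1) p.2).
  apply: segment_supported => i; rewrite gtn_max => /andP[N1i N2i].
    exact: gN1.
  exact: gN2.
apply: (@continuous_into_sphere _ _ _ N) => [p|i].
  exact/normalize_supported/sN.
have sc j : continuous (fun p : K * set_type (@simplex R 1) =>
    segment (g p.1) (g' p.1) p.2 j).
  have tc l :
      continuous (fun p : K * set_type (@simplex R 1) => val p.2 ord0 l).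
    move=> p; apply: (@continuous_comp _ _ _ snd (fun t => val t ord0 l)).
      exact: cvg_snd.
    exact: simplex_coord_continuous.
  have cc (h : K -> infinite_sphere R) : continuous h ->
      continuous (fun p : K * set_type (@simplex R 1) => sval (h p.1) j).
    move=> hc p; apply: (@continuous_comp _ _ _ fst (fun a => sval (h a) j)).
      exact: cvg_fst.
    apply: (@continuous_comp _ _ _ h (fun x => sval x j)); first exact: hc.
    exact: sphere_coord_continuous.
  apply: continuous_add; apply: continuous_mul; by [exact: tc|exact: cc].
pose nrm p := Num.sqrt (total (fun i => segment (g p.1) (g' p.1) p.2 i ^+ 2)).
have nrmc : continuous nrm.
  have -> : nrm = (fun p =>
      Num.sqrt (\sum_(i < N.+1) segment (g p.1) (g' p.1) p.2 i ^+ 2)).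
    by apply/funext => q; rewrite /nrm (totalE (supported_sq (sN q))).
  move=> p; apply: (@continuous_comp _ _ _
    (fun p => \sum_(i < N.+1) segment (g p.1) (g' p.1) p.2 i ^+ 2)).
    apply: continuous_big => [|j _]; first exact: add_continuous.
    exact: continuous_mul.
  exact: sqrt_continuous.
apply: (@continuous_mul _ _ (fun p => segment (g p.1) (g' p.1) p.2 i)
  (fun p => (nrm p)^-1)) => // p.
have nrm0 : nrm p != 0 by rewrite sqrtr_eq0 -ltNge; exact: segment_gt0.
exact: (cvgV nrm0 (nrmc p)).
Qed.
End Segment.

(** * The homotopy between orbit maps *)

Section OrbitHomotopy.
Local Open Scope quotient_scope.
Import ArrowAsCompactOpen.
Context {R : realType} {X : z2space}.
Variables u v : z2map X (infinite_sphere R).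
Hypothesis uv : forall x, u x <> flip (v x).

Definition orbit_homotopy (p : orbit_space X) (t : set_type (@simplex R 1)) :
    infinite_projective_space R :=
  orbit (sphere_segment (@uv (repr (p : {eq_quot orbit_equiv X}))) t).

(** The representative chosen for the orbit is x or its flip; in the second case the segment is
    flipped too, so its orbit is the same. *)
Lemma orbit_homotopyE (x : X) (t : set_type (@simplex R 1)) :
  orbit_homotopy (orbit x) t = orbit (sphere_segment (@uv x) t).
Proof.
have : orbit (repr (orbit x : {eq_quot orbit_equiv X})) = orbit x.
  exact: reprK.
rewrite /orbit_homotopy; move: (repr _) => y /orbitP[->//|xy]; subst x.
have := sphere_segment_flip (@uv y) (@uv (flip y)) t.
by move=> -> //; rewrite ?orbit_flip // z2fun_flip.
Qed.

Lemma orbit_segment_continuous (K : topologicalType) (g : K -> X) :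
  compact [set: K] -> continuous g ->
  continuous (fun q : K * set_type (@simplex R 1) =>
    orbit (sphere_segment (@uv (g q.1)) q.2)).
Proof.
move=> Kc gc q.
have ugc (w : z2map X (infinite_sphere R)) : continuous (w \o g).
  by move=> a; apply: continuous_comp; [exact: gc|exact: z2fun_continuous].
apply: (@continuous_comp _ _ _
  (fun q => sphere_segment (@uv (g q.1)) q.2) (@orbit _)).
  exact: (@sphere_segment_continuous R K (u \o g) (v \o g)
    (fun a => @uv (g a)) Kc (ugc u) (ugc v) q).
exact: pi_continuous.
Qed.

(** A curried map leaves the orbit space itself and not its product with Delta^1, so the quotient
    topology and then compact probes of X apply directly. The target carries the compact-open
    topology, and Delta^1 is locally compact and regular, which allows uncurrying. *)
Lemma orbit_homotopy_continuous : compactly_generated X ->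
  continuous (uncurry orbit_homotopy).
Proof.
move=> Xc; have Dc := @simplex_compact R 1.
have curryE (K : topologicalType) (g : K -> X) :
    orbit_homotopy \o @orbit X \o g =
    curry (fun q : K * set_type (@simplex R 1) =>
      orbit (sphere_segment (@uv (g q.1)) q.2)).
  by apply/funext => a; apply/funext => t; exact: orbit_homotopyE.
apply: continuous_uncurry_regular.
- move=> t _; exists setT; first exact: filterT.
  by split=> //; exact: closedT.
- exact: uniform_regular.
- apply/quotient_continuous/Xc => K g Kc gc.
  rewrite [X in continuous X]curryE; apply: continuous_curry_fun.
  exact: orbit_segment_continuous.
(* Each single path must be continuous as well. This comes from the constant probe at x; its domain
   Delta^1 is compact and has the point t at which to evaluate. *)
move=> p t; pose x := repr (p : {eq_quot orbit_equiv X}).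
have [_ cF] := continuous_curry (orbit_segment_continuous
  (K := set_type (@simplex R 1)) (g := fun=> x) Dc (@cst_continuous _ _ x)).
have -> : orbit_homotopy p = orbit_homotopy (orbit x).
  by congr orbit_homotopy; exact/esym/reprK.
have -> := congr1 (@^~ t) (curryE _ (fun _ : set_type (@simplex R 1) => x)) :
  orbit_homotopy (orbit x) = _.
exact: cF.
Qed.

Lemma orbit_map_cohomologous (z : cochain R 1 (infinite_projective_space R)) :
  compactly_generated X -> cocycle z ->
  cohomologous (pullback (orbit_map u) z) (pullback (orbit_map v) z).
Proof.
move=> Xc; apply: (@homotopy_cohomologous _ _ _
  (mkcts (orbit_homotopy_continuous Xc))).
  move=> p t; have [x ->] : exists x, p = orbit x.
    by exists (repr (p : {eq_quot orbit_equiv X})); exact/esym/reprK.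
  apply: etrans (orbit_homotopyE _ _) (etrans _ (esym (orbit_map_funE u x))).
  by rewrite sphere_segment0.
move=> p t; have [x ->] : exists x, p = orbit x.
  by exists (repr (p : {eq_quot orbit_equiv X})); exact/esym/reprK.
apply: etrans (orbit_homotopyE _ _) (etrans _ (esym (orbit_map_funE v x))).
by rewrite sphere_segment1.
Qed.
End OrbitHomotopy.

(** * Spreading coordinates over even or odd indices *)

Section Spread.
Context {R : realType}.
Implicit Types (f : nat -> R) (x y : infinite_sphere R) (b : bool).

Definition spread b f (i : nat) : R := if odd i == b then f i./2 else 0.

Lemma spread_supported b f N :
  supported N f -> supported N.*2.+1 (spread b f).
Proof.
move=> fN i Ni; rewrite /spread fN ?if_same //; lia.
Qed.

Lemma spread_total b f N : supported N f ->
  total (fun i => spread b f i ^+ 2) = total (fun i => f i ^+ 2).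
Proof.
move=> fN; rewrite (totalE (supported_sq fN)).
rewrite (totalE (supported_sq (spread_supported b fN))) -doubleS.
(* Indices 2n and 2n+1 are taken together: one of them carries f n, the other 0. *)
elim: N.+1 => [|n IHn]; first by rewrite !big_ord0.
rewrite doubleS !big_ord_recr /= IHn -addrA; congr (_ + _).
rewrite /spread /= odd_double uphalf_double half_double.
by case: (b); rewrite expr0n ?add0r ?addr0.
Qed.

Lemma sphere_spread_subproof b x :
  exists n a, @zero_extend R n a = spread b (sval x).
Proof.
have [N xN] := sphere_supported x.
apply: (zero_extend_ex (spread_supported b xN)).
by rewrite (spread_total b xN) sphere_total.
Qed.

Definition sphere_spread_fun b x : infinite_sphere R :=
  exist _ (spread b (sval x)) (sphere_spread_subproof b x).

Lemma sphere_spread_continuous b : continuous (sphere_spread_fun b).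
Proof.
apply: union_continuous => N.
apply: (@continuous_into_sphere _ _ _ N.*2.+1) => [a|i].
  apply: spread_supported => i Ni.
  by rewrite /= /zero_extend leqNgt Ni.
rewrite /comp /= /spread; case: eqP => _; last exact: cst_continuous.
move=> a; apply: (@continuous_comp _ _ _ (union_in (@zero_extend R) (i := N))
  (fun x => sval x i./2)); first exact: union_in_continuous.
exact: sphere_coord_continuous.
Qed.

Lemma sphere_spread_flip b x :
  sphere_spread_fun b (flip x) = flip (sphere_spread_fun b x).
Proof.
apply: union_inj; apply/funext => i /=; rewrite /spread.
by case: eqP; rewrite ?oppr0.
Qed.

Definition sphere_spread b : z2map (infinite_sphere R) (infinite_sphere R) :=
  Z2Map (@sphere_spread_continuous b) (sphere_spread_flip b).

Lemma sphere_neq0 x : ~ forall i, sval x i = 0.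
Proof.
move=> x0; have := sphere_total x; rewrite (@totalE _ 0%N) => [|i _].
  by rewrite big_ord1 x0 expr0n => /esym/eqP; rewrite oner_eq0.
by rewrite x0 expr0n.
Qed.

(** Otherwise coordinate i of x is 0 or minus coordinate i./2. Strong induction then kills every
    coordinate; at i = 0 a number equal to its own negative is 0. *)
Lemma spread_not_antipodal b x : x <> flip (sphere_spread b x).
Proof.
move=> xE; apply: (@sphere_neq0 x); elim/ltn_ind => i IHi.
have := congr1 (fun y : infinite_sphere R => sval y i) xE; rewrite /= /spread.
case: eqP => [ib|_]; last by rewrite oppr0.
case: i => [|i] in IHi ib *; last first.
  have ii : (i.+1./2 < i.+1)%N by lia.
  by rewrite (IHi _ ii) oppr0.
by move/eqP; rewrite -addr_eq0 -mulr2n mulrn_eq0 => /eqP.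
Qed.

(** At index 2i the left side has coordinate i of x and the right side 0, so equality would make x
    zero. *)
Lemma spread_disjoint x y :
  sphere_spread false x <> flip (sphere_spread true y).
Proof.
move=> xy; apply: (@sphere_neq0 x) => i.
have := congr1 (fun y : infinite_sphere R => sval y i.*2) xy.
by rewrite /= /spread odd_double half_double /= oppr0.
Qed.
End Spread.

(** * Composites of equivariant maps and independence of the map to S^oo *)

Lemma z2comp_flip (X Y Z : z2space) (g : z2map Y Z) (f : z2map X Y) x :
  (g \o f) (flip x) = flip ((g \o f) x).
Proof. by rewrite /= !z2fun_flip. Qed.

Lemma z2comp_continuous (X Y Z : z2space) (g : z2map Y Z) (f : z2map X Y) :
  continuous (g \o f).
Proof. by move=> x; apply: continuous_comp; exact: z2fun_continuous. Qed.

Definition z2comp (X Y Z : z2space) (g : z2map Y Z) (f : z2map X Y) :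
    z2map X Z :=
  Z2Map (@z2comp_continuous X Y Z g f) (z2comp_flip g f).

Lemma orbit_map_comp (X Y Z : z2space) (g : z2map Y Z) (f : z2map X Y) :
  orbit_map (z2comp g f) = (orbit_map g \o orbit_map f : continuousType _ _).
Proof.
apply/continuousEP => p; have [x ->] : exists x, p = orbit x.
  by exists (repr (p : {eq_quot orbit_equiv X}%qT)); exact/esym/reprK.
have -> := orbit_map_funE (z2comp g f) x : orbit_map _ _ = _.
by rewrite /= /orbit_map /= /mkcts !orbit_map_funE.
Qed.

Lemma orbit_map_pullback_unique (R : realType) (X : z2space)
    (u v : z2map X (infinite_sphere R))
    (z : cochain R 1 (infinite_projective_space R)) :
  compactly_generated X -> cocycle z ->
  cohomologous (pullback (orbit_map u) z) (pullback (orbit_map v) z).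
Proof.
move=> Xc zz.
have spreadE b (w : z2map X (infinite_sphere R)) :
    cohomologous (pullback (orbit_map w) z)
                 (pullback (orbit_map (z2comp (sphere_spread b) w)) z).
  by apply: orbit_map_cohomologous => // x; exact: spread_not_antipodal.
(* The values of u and v may be antipodal, so the passage is from u to its even spread, to the odd
   spread of v, to v. *)
apply: cohomologous_trans (spreadE false u) _.
apply: cohomologous_trans (cohomologous_sym (spreadE true v)).
by apply: orbit_map_cohomologous => // x; exact: spread_disjoint.
Qed.

(** * Functoriality of the realization of a poset *)

Section RealizationMap.
Context {R : realType} {P Q : Type}.
Context {leP : P -> P -> Prop} {leQ : Q -> Q -> Prop}.
Variable F : P -> Q.
Hypothesis F_mono : forall p p', leP p p' -> leQ (F p) (F p').

Definition chain_map (p : chain leP) : chain leQ :=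
  Chain (fun i j ij => F_mono (chain_mono (c := p) ij)).

(** Grouping by elements of P shows that such sums depend on t only through its barycentric
    coordinates. The list r keeps the sum finite, and [{classic P}] supplies decidable equality. *)
Lemma barycentric_sum (p : chain leP) (t : set_type (@simplex R (chain_dim p)))
    (A : pred P) (r : seq {classic P}) :
  uniq r -> (forall i, (p i : {classic P}) \in r) ->
  \sum_(i | A (p i)) val t ord0 i = \sum_(a <- r | A a) barycentric t a.
Proof.
move=> ur pr; rewrite /barycentric (exchange_big_dep predT) //=.
rewrite big_mkcond; apply: eq_bigr => i _.
rewrite big_mkcond (bigD1_seq (p i : {classic P})) //= big1 ?addr0.
  by rewrite asboolT // andbT.
by move=> a ai; rewrite asboolF ?andbF // => pia; rewrite pia eqxx in ai.
Qed.

(** The image coordinate at q is the sum of the coordinates over the fibre of F at q. Taken over one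
    list r containing both chains, it sees only the point and not the chain. *)
Lemma barycentric_map_eq (p p' : chain leP)
    (t : set_type (@simplex R (chain_dim p)))
    (t' : set_type (@simplex R (chain_dim p'))) :
  barycentric t = barycentric t' ->
  barycentric (p := chain_map p) t = barycentric (p := chain_map p') t'.
Proof.
move=> tt'; apply/funext => q.
pose r := undup ([seq (p i : {classic P}) | i : 'I_(chain_dim p).+1] ++
                 [seq (p' i : {classic P}) | i : 'I_(chain_dim p').+1]).
have pr i : (p i : {classic P}) \in r.
  by rewrite mem_undup mem_cat map_f ?mem_enum.
have p'r i : (p' i : {classic P}) \in r.
  by rewrite mem_undup mem_cat [X in _ || X]map_f ?mem_enum ?orbT.
have ur : uniq r by exact: undup_uniq.
rewrite /barycentric /=.
rewrite (barycentric_sum t (fun a => `[< F a = q >]) ur pr).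
by rewrite (barycentric_sum t' (fun a => `[< F a = q >]) ur p'r) tt'.
Qed.

(** The point y must fit every presentation of x, so that the value picked by [cid] can be computed
    on any chain. *)
Lemma realization_map_subproof (x : realization R leP) :
  exists y : realization R leQ, forall p t,
    union_in (@barycentric R P leP) (i := p) t = x ->
    union_in (@barycentric R Q leQ) (i := chain_map p) t = y.
Proof.
have [p [t tx]] := unionP x.
exists (union_in (@barycentric R Q leQ) (i := chain_map p) t) => p' t' t'x.
apply: union_inj; apply: barycentric_map_eq.
by have /(congr1 sval) := etrans t'x (esym tx).
Qed.

Definition realization_map (x : realization R leP) : realization R leQ :=
  sval (cid (realization_map_subproof x)).

Lemma realization_mapE p (t : set_type (@simplex R (chain_dim p))) :
  realization_map (union_in (@barycentric R P leP) t) =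
  union_in (@barycentric R Q leQ) (i := chain_map p) t.
Proof. by rewrite /realization_map; case: cid => y /= /(_ p t erefl). Qed.

Lemma realization_map_continuous : continuous realization_map.
Proof.
apply: union_continuous => p.
have -> : realization_map \o union_in (@barycentric R P leP) (i := p) =
    union_in (@barycentric R Q leQ) (i := chain_map p).
  by apply/funext => t; exact: realization_mapE.
exact: (union_in_continuous (i := chain_map p)).
Qed.
End RealizationMap.

(** * Functoriality of Hom(T, -), with the involution *)

Section HomComplexMap.
Context {R : realType} {T G H : graph} (phi : graph_involution T).
Variables (c : G -> H) (c_hom : graph_hom c).

Lemma multihom_map_neq0 (eta : multihom T G) x : (c @` eta x) !=set0.
Proof. by have [y yx] := mhom_neq0 eta x; exists (c y), y. Qed.

Lemma multihom_map_edge (eta : multihom T G) x y : edge x y ->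
  forall x' y', (c @` eta x) x' -> (c @` eta y) y' -> edge x' y'.
Proof.
move=> xy _ _ [x' x'x <-] [y' y'y <-]; apply: c_hom.
exact: (mhom_edge (m := eta) xy).
Qed.

Definition multihom_map (eta : multihom T G) : multihom T H :=
  Multihom (multihom_map_neq0 eta) (@multihom_map_edge eta).

Lemma multihom_map_le eta eta' :
  multihom_le eta eta' -> multihom_le (multihom_map eta) (multihom_map eta').
Proof. by move=> le_eta x; apply: image_subset; exact: le_eta. Qed.

Lemma multihom_map_act eta :
  multihom_map (multihom_act phi eta) = multihom_act phi (multihom_map eta).
Proof. exact: multihom_inj. Qed.

Definition hom_complex_map : hom_complex R T G -> hom_complex R T H :=
  realization_map multihom_map_le.

Lemma hom_act_union_in (K : graph) (p : chain (@multihom_le T K))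
    (t : set_type (@simplex R (chain_dim p))) :
  hom_act phi (union_in (@barycentric R _ (@multihom_le T K)) t) =
  union_in (@barycentric R _ (@multihom_le T K)) (i := chain_act phi p) t.
Proof. by apply: union_inj; rewrite /= barycentric_act. Qed.

Lemma hom_complex_map_flip (x : hom_z2space R G phi) :
  hom_complex_map (flip x) = flip (hom_complex_map x : hom_z2space R H phi).
Proof.
have [p [t <-]] := unionP x; rewrite /= hom_act_union_in /hom_complex_map.
rewrite !realization_mapE hom_act_union_in; apply: union_inj => /=.
by apply/funext => q; apply: eq_bigl => i /=; rewrite multihom_map_act.
Qed.

Definition hom_z2map : z2map (hom_z2space R G phi) (hom_z2space R H phi) :=
  @Z2Map (hom_z2space R G phi) (hom_z2space R H phi) hom_complex_map
    (realization_map_continuous (F_mono := multihom_map_le))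
    hom_complex_map_flip.
End HomComplexMap.

Lemma hom_compactly_generated (R : realType) (T G : graph)
    (phi : graph_involution T) : compactly_generated (hom_z2space R G phi).
Proof.
by apply: union_space_compactly_generated => p; exact: simplex_compact.
Qed.

(** * Colourings and the bound on the chromatic number *)

Lemma colorable_leq (G : graph) n m : (n <= m)%N -> colorable G n ->
  exists c : G -> complete_graph m, graph_hom c.
Proof.
move=> nm [c cP]; exists (widen_ord nm \o c) => x y xy /= /(congr1 val) /= cxy.
by apply: (cP x y xy); exact: val_inj.
Qed.

Theorem theorem2p1 (R : realType) (G T : graph) (phi : graph_involution T)
    (k m : nat)
    (z : cochain R 1 (infinite_projective_space R))
    (u : z2map (hom_z2space R G phi) (infinite_sphere R))
    (v : z2map (hom_z2space R (complete_graph m) phi) (infinite_sphere R)) :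
  loopless G -> flips_edge phi -> (1 <= m)%N ->
  cocycle z -> ~ coboundary z ->
  ~ coboundary (stiefel_whitney_power z u k) ->
  coboundary (stiefel_whitney_power z v k) ->
  ((m.+1%:R)%:E <= chromatic_number R G)%E.
Proof.
(* A lower bound of the infimum is checked on each n admitting a colouring; with no such n the value
   is +oo and nothing remains. *)
move=> _ _ _ zz _ u_neq0 v_eq0; apply: le_ereal_inf_tmp => _ [n Gn <-].
rewrite lee_fin ler_nat ltnNge; apply/negP => /colorable_leq /(_ Gn) [c c_hom].
apply: u_neq0; pose f := hom_z2map (R := R) phi c_hom.
have := pullback_coboundary (orbit_map f) v_eq0.
rewrite /stiefel_whitney_power !pullback_cup_power.
have -> : pullback (orbit_map f) (pullback (orbit_map v) z) =
    pullback (orbit_map (z2comp v f)) z.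
  by rewrite orbit_map_comp; apply/funext => s; congr z; exact/continuousEP.
(* The power for [v \o f] is a coboundary by naturality; it remains to compare u with [v \o f] on
   Hom(T, G), in degree 1. *)
apply: cohomologous_coboundary; apply: cohomologous_cup_power.
- exact: pullback_cocycle.
- exact: pullback_cocycle.
- by apply: orbit_map_pullback_unique => //; exact: hom_compactly_generated.
Qed.
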